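(* Let $\rho_0\in \mathrm{L}^\infty(\mathbb{R})$ satisfy $0\le\rho_0\le 1$ and $\mathrm{TV}(\rho_0)<+\infty$, and let $V\in\mathrm{Lip}([0,1])$ be a real-valued Lipschitz function with $V'\le 0$ in $[0,1]$. Let $\varepsilon,h>0$ and let the quadrature weights $\{\gamma_k^{\varepsilon,h}\}_{k\ge0}$ satisfy: $\gamma_k^{\varepsilon,h}\ge\gamma_{k+1}^{\varepsilon,h}\ge 0$ for all $k\ge 0$; $\sum_{k=0}^\infty\gamma_k^{\varepsilon,h}=1$; and $\gamma_{k-1}^{\varepsilon,h}+\gamma_{k+1}^{\varepsilon,h}-2\gamma_k^{\varepsilon,h}\ge 0$ for all $k\ge 1$. Assume the CFL condition $\lambda\big(\|V\|_{\mathrm{L}^\infty}+2\|V'\|_{\mathrm{L}^\infty}\big)\le 1$. Let $\{\rho_j^n\}_{j\in\mathbb{Z}}^{n\ge 0}$ and $\{W_j^n\}_{j\in\mathbb{Z}}^{n\ge 0}$ be the numerical solutions produced by the scheme described in the context. Then $$\sum_{j\in\mathbb{Z}}|W_{j+1}^{n+1}-W_j^{n+1}|\le\sum_{j\in\mathbb{Z}}|W_{j+1}^n-W_j^n|\le\mathrm{TV}(\rho_0)\qquad\text{for all }n\ge 0 .$$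
   Context: Numerical scheme: let $\varepsilon>0$ be the nonlocal horizon parameter, $h>0$ the spatial mesh size, $\tau>0$ the time step, and $\lambda=\tau/h$ the CFL ratio. Given weights $\{\gamma_k^{\varepsilon,h}\}_{k\ge0}$, define, for $j\in\mathbb{Z}$ and $n\ge 0$, $$\rho_j^0=\frac1h\int_{(j-\frac12)h}^{(j+\frac12)h}\rho_0(x)\,dx,\qquad W_j^n=\sum_{k=0}^\infty\gamma_k^{\varepsilon,h}\rho_{j+k}^n,\qquad \rho_j^{n+1}=\rho_j^n+\lambda\big(\rho_{j-1}^nV(W_j^n)-\rho_j^nV(W_{j+1}^n)\big).$$ $\mathrm{TV}$ is the total variation over $\mathbb{R}$; $\|V\|_{\mathrm{L}^\infty}$ and $\|V'\|_{\mathrm{L}^\infty}$ are norms over $[0,1]$.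
   Formalization: The formal statement adds V ≥ 0 on [0,1]; without it the claim is false, e.g. V ≡ −c with c > 0, γ_0 = 1, λc ≤ 1 and ρ_0 the indicator of one cell, where the sum over j of |W_{j+1} − W_j| grows from 2 to 2 + 4λc in one step. *)

(* Defs.v *)
(* MathComp-Analysis; [R : realType] is the field of real numbers. *)
From HB Require Import structures.
From mathcomp Require Export all_boot all_order all_algebra.
From mathcomp Require Export all_classical all_reals all_analysis.
Export Order.TTheory GRing.Theory Num.Theory.
Export numFieldNormedType.Exports.

Set Implicit Arguments.
Unset Strict Implicit.
Unset Printing Implicit Defensive.

Global Open Scope classical_set_scope.
Global Open Scope ring_scope.

(* Supremum of [\sum_i |f x_(i+1) - f x_i|] over all finite increasing
   sequences of reals. *)
Definition pointwise_TV (R : realType) (f : R -> R) : \bar R :=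
  ereal_sup [set total_variation ab.1 ab.2 f | ab in [set: R * R]].

(* Total variation over the real line of the class of [f] modulo equality
   almost everywhere: the least pointwise variation of a representative. *)
Definition TV (R : realType) (f : R -> R) : \bar R :=
  ereal_inf [set pointwise_TV g |
             g in [set g : R -> R | g = f %[ae @lebesgue_measure R]]].

(* L^infty norm over [0, 1]; extending [f] by 0 outside [0, 1] does not change
   the essential supremum of its absolute value. *)
Definition Linfty01 (R : realType) (f : R -> R) : \bar R :=
  ('N[@lebesgue_measure R]_+oo [EFin \o (f \_ `[0%R, 1%R])])%E.

Definition cell_average (R : realType) (h : R) (f : R -> R) (j : int) : R :=
  h^-1 * \int[@lebesgue_measure R]_(x in
           `[(j%:~R - 2^-1) * h, (j%:~R + 2^-1) * h]) f x.

Definition nonlocal_term (R : realType) (g : R^nat) (rho : int -> R) (j : int)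
    : R :=
  limn (series (fun k : nat => g k * rho (j + k%:Z))).

(* The flux [rho_j V(W_(j+1))] takes the density from the left: this is upwind
   only for nonnegative velocities, and for [V < 0] the scheme is unstable. *)
Fixpoint scheme_rho (R : realType) (V : R -> R) (g : R^nat) (h tau : R)
    (rho0 : R -> R) (n : nat) : int -> R :=
  if n is m.+1 then
    let rho := scheme_rho V g h tau rho0 m in
    let W := nonlocal_term g rho in
    fun j => rho j + tau / h * (rho (j - 1) * V (W j) - rho j * V (W (j + 1)))
  else cell_average h rho0.

Definition scheme_W (R : realType) (V : R -> R) (g : R^nat) (h tau : R)
    (rho0 : R -> R) (n : nat) : int -> R :=
  nonlocal_term g (scheme_rho V g h tau rho0 n).

(* Main.v *)
Require Import Defs.
From HB Require Import structures.
From mathcomp Require Import measurable_realfun ess_sup_inf lra ring zify.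

(* With [V_j = V(W_j)], [D_j = W_(j+1) - W_j], [d_k = gamma_k - gamma_(k+1)] and
   [S_j = sum_k d_k rho_(j+k)], summation by parts turns the scheme into
     D_j^(n+1) = (1 - lambda V_(j+1)) D_j - lambda S_j (V_j - V_(j+1))
       + lambda V_j D_(j-1)
       + lambda sum_k (d_k - d_(k+1)) rho_(j+1+k) (V_(j+1) - V_(j+k+2)).
   Since [V] is nonincreasing, [V_j - V_(j+1)] has the sign of [D_j] and is at
   most [L |D_j|], so by the CFL condition the first two terms have modulus
   [(1 - lambda V_(j+1)) |D_j| - lambda S_j |V_j - V_(j+1)|].  Convexity gives
   [d_k >= d_(k+1)]; telescoping [V_(j+1) - V_(j+k+2)] and summing over [j], the
   last term contributes at most [lambda sum_l S_l |V_l - V_(l+1)|], which the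
   second term compensates.

   Monotonicity of [V] and the bound on its slopes are only given through [V']
   almost everywhere; they follow from the fundamental theorem of calculus for
   Lipschitz functions, obtained by differentiating the integral of the
   Radon-Nikodym density of the Lebesgue-Stieltjes measure of a nondecreasing
   modification of [V]. *)

(** * Total variation along the scheme *)

Lemma esum_shift (R : realType) (a : int -> \bar R) (m : int) :
  \esum_(j in [set: int]) a j = \esum_(j in [set: int]) a (j + m).
Proof.
apply: (reindex_esum [set: int] [set: int] (fun j => j + m)); split => //.
- by move=> x y _ _ /addIr.
- by move=> y _; exists (y - m); rewrite ?subrK.
Qed.

(** Lower semicontinuity of the l^1 norm under pointwise convergence: each finite partial sum passes
    to the limit. It lets all estimates be made on truncated sums. *)
Lemma esum_cvg_le (R : realType) (I : choiceType) (D : set I)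
    (u : nat -> I -> R) (l : I -> R) (T : \bar R) :
  (forall i, u ^~ i @ \oo --> l i) ->
  (forall n, \esum_(i in D) `|u n i|%:E <= T)%E ->
  (\esum_(i in D) `|l i|%:E <= T)%E.
Proof.
move=> ul uT; apply: ge_ereal_sup => _ [X [finX XD] <-].
rewrite fsbig_finite//=.
set s := finmap.enum_fset _.
have cvgX : (\sum_(i <- s) `|u n i|%:E)%E @[n --> \oo] -->
    (\sum_(i <- s) `|l i|%:E)%E.
  apply: cvg_nnesum => i _; first by apply: nearW => n; rewrite lee_fin.
  by apply: cvg_EFin; [exact: nearW|exact: cvg_norm].
apply: (cvge_to_le cvgX).
apply: nearW => n; apply: le_trans (uT n).
apply: ereal_sup_ubound; exists X => //.
by rewrite fsbig_finite.
Qed.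

(** Young's inequality for a convolution with weights of mass at most 1: exchange the two sums and
    use translation invariance of the sum over the integers. *)
Lemma esum_moving_sum_le (R : realType) (w : R^nat) (a : int -> R) :
  (forall k, 0 <= w k) -> (forall n, series w n <= 1) -> forall n,
  (\esum_(j in [set: int]) `|\sum_(0 <= k < n) w k * a (j + k%:Z)|%:E
     <= \esum_(j in [set: int]) `|a j|%:E)%E.
Proof.
move=> w0 w1 n.
apply: (@le_trans _ _ (\esum_(j in [set: int])
    \sum_(0 <= k < n) (w k * `|a (j + k%:Z)|)%:E)%E).
  apply: le_esum => j _; rewrite sumEFin lee_fin.
  rewrite (le_trans (ler_norm_sum _ _ _))//.
  by apply: ler_sum => k _; rewrite normrM ger0_norm.
rewrite esum_sum; last by move=> *; rewrite lee_fin mulr_ge0.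
rewrite (eq_bigr (fun k => \esum_(j in [set: int]) (w k * `|a j|)%:E)%E); last first.
  by move=> k _; rewrite [RHS](esum_shift _ _ k%:Z).
rewrite -esum_sum; last by move=> *; rewrite lee_fin mulr_ge0.
apply: le_esum => j _; rewrite sumEFin lee_fin -mulr_suml.
by apply: ler_piMl => //; exact: w1.
Qed.

(** * Averages against the quadrature weights *)

Section nonlocal_term.
Context (R : realType) (g : R^nat).
Hypothesis g_ge0 : forall k, 0 <= g k.
Hypothesis g_sum : series g @ \oo --> (1 : R).

Lemma series_weights_le1 n : series g n <= 1.
Proof.
rewrite -(cvg_lim _ g_sum)//; apply: nondecreasing_cvgn_le.
  by apply/nondecreasing_seqP => k; rewrite seriesSr lerDl.
by apply: cvgP; exact: g_sum.
Qed.

Lemma weights0_le1 : g 0%N <= 1.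
Proof.
by have := series_weights_le1 1%N; rewrite seriesSr seriesEnat/= big_nil add0r.
Qed.

Lemma weights_cvg0 : g @ \oo --> (0 : R).
Proof. by apply: cvg_series_cvg_0; apply: cvgP; exact: g_sum. Qed.

Variable rho : int -> R.
Hypothesis rho01 : forall j, 0 <= rho j <= 1.

(** Comparison with the series of weights. Since [nonlocal_term] is a [limn], it carries information
    only once this convergence is known. *)
Lemma nonlocal_term_cvg j :
  series (fun k => g k * rho (j + k%:Z)) @ \oo --> nonlocal_term g rho j.
Proof.
apply: (@series_le_cvg _ _ g) => [k|//|k|].
- by rewrite mulr_ge0//; case/andP: (rho01 (j + k%:Z)).
- by rewrite ler_piMr//; case/andP: (rho01 (j + k%:Z)).
- by apply: cvgP; exact: g_sum.
Qed.

Lemma nonlocal_term01 j : 0 <= nonlocal_term g rho j <= 1.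
Proof.
have cW := nonlocal_term_cvg j.
apply/andP; split.
- rewrite -(cvg_lim _ cW)//; apply: limr_ge; first exact: cvgP cW.
  apply: nearW => n; apply: sumr_ge0 => k _; rewrite mulr_ge0//.
  by case/andP: (rho01 (j + k%:Z)).
- rewrite -(cvg_lim _ cW)//; apply: limr_le; first exact: cvgP cW.
  apply: nearW => n; apply: le_trans (series_weights_le1 n).
  apply: ler_sum => k _; rewrite ler_piMr//.
  by case/andP: (rho01 (j + k%:Z)).
Qed.

Lemma nonlocal_term_shift_sub j :
  \sum_(0 <= k < n) g k * (rho (j + 1 + k%:Z) - rho (j + k%:Z)) @[n --> \oo]
  --> nonlocal_term g rho (j + 1) - nonlocal_term g rho j.
Proof.
apply: cvg_trans (cvgB (nonlocal_term_cvg (j + 1)) (nonlocal_term_cvg j)).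
apply: near_eq_cvg; apply: nearW => n.
by rewrite /= /series/= !fctE -sumrB; apply: eq_bigr => k _; rewrite mulrBr.
Qed.

(** The increments of the nonlocal term are weighted averages of the increments of [rho],
    approximated by moving sums. This is the bound at the initial time. *)
Lemma nonlocal_term_variation_le :
  (\esum_(j in [set: int]) `|nonlocal_term g rho (j + 1) - nonlocal_term g rho j|%:E
     <= \esum_(j in [set: int]) `|rho (j + 1) - rho j|%:E)%E.
Proof.
apply: (esum_cvg_le _ _ _ (fun n j =>
  \sum_(0 <= k < n) g k * (rho (j + 1 + k%:Z) - rho (j + k%:Z)))).
  exact: nonlocal_term_shift_sub.
move=> n; have := esum_moving_sum_le _ _ (fun j => rho (j + 1) - rho j)
  g_ge0 series_weights_le1 n.
by under eq_esum do under eq_bigr do rewrite addrAC.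
Qed.
End nonlocal_term.

(** * Algebraic identities for one time step *)

(** Splitting off the constant velocity [v j] makes the remaining flux vanish at the left end, so
    summation by parts leaves only the boundary term at [K], which carries the factor [g K]. *)
Lemma flux_partial_sum (R : comRingType) (g : nat -> R) (lam : R)
    (rho v : int -> R) (j : int) (K : nat) :
  let P i := \sum_(0 <= k < K) g k * rho (i + k%:Z) in
  \sum_(0 <= k < K) g k * (rho (j + k%:Z) + lam *
      (rho (j + k%:Z - 1) * v (j + k%:Z) - rho (j + k%:Z) * v (j + k%:Z + 1)))
  = P j + lam * (v j * (P (j - 1) - P j)
      + \sum_(0 <= k < K) (g k - g k.+1) * rho (j + k%:Z)
          * (v j - v (j + k%:Z + 1))
      + g K * rho (j + K%:Z - 1) * (v j - v (j + K%:Z))).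
Proof.
move=> P; rewrite /P {P}; elim: K => [|K IH].
  by rewrite !big_nil !addr0; ring.
rewrite big_nat_recr//= IH !big_nat_recr//=.
have -> : j + K.+1%:Z = j + K%:Z + 1 by rewrite intS; ring.
have -> : j - 1 + K%:Z = j + K%:Z - 1 by ring.
by rewrite addrK; ring.
Qed.

Lemma convex_weights_sum (R : comRingType) (d r : nat -> R) (K : nat) :
  \sum_(0 <= k < K) (d k - d k.+1) * \sum_(0 <= i < k.+1) r i
    + d K * \sum_(0 <= i < K) r i = \sum_(0 <= k < K) d k * r k.
Proof.
elim: K => [|K IH]; first by rewrite !big_nil; ring.
by rewrite !big_nat_recr//= -IH; ring.
Qed.

(** Equality in the reverse triangle inequality: the subtracted term lowers the modulus by its full
    size, a gain that the triangle inequality would lose. *)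
Lemma normrB_same_sign (R : realDomainType) (A B x y : R) :
  0 <= y * x -> 0 <= A * `|x| - B * `|y| -> 0 <= A -> 0 <= B ->
  `|A * x - B * y| = A * `|x| - B * `|y|.
Proof.
move=> yx h A0 B0; case: (ltrgtP x 0) yx h => [x0|x0|->].
- rewrite nmulr_lge0// => y0; rewrite (ltr0_norm x0) (ler0_norm y0) => h.
  by rewrite ler0_norm; lra.
- rewrite pmulr_lge0// => y0; rewrite (gtr0_norm x0) (ger0_norm y0) => h.
  by rewrite ger0_norm; lra.
(* For [x = 0] the sign condition says nothing on [y], but the second hypothesis forces
   [B * |y| = 0]. *)
- move=> _; rewrite normr0 !mulr0 !sub0r oppr_ge0 normrN normrM ger0_norm//.
  move=> h; suff -> : B * `|y| = 0 by rewrite oppr0.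
  by apply/eqP; rewrite eq_le h mulr_ge0.
Qed.

(** * One time step does not increase the variation *)

Section variation_diminishing.
Context (R : realType) (g : R^nat) (lam L M : R) (rho v : int -> R).
Hypothesis g_noninc : forall k, 0 <= g k.+1 <= g k.
Hypothesis g_sum : series g @ \oo --> (1 : R).
Hypothesis g_convex : forall k, g k.+1 - g k.+2 <= g k - g k.+1.
Hypothesis rho01 : forall j, 0 <= rho j <= 1.
Hypotheses (lam_ge0 : 0 <= lam) (L_ge0 : 0 <= L) (lamLM : lam * (M + L) <= 1).
Let W := nonlocal_term g rho.
Hypothesis v0M : forall j, 0 <= v j <= M.
Hypothesis v_sign : forall j, 0 <= (v j - v (j + 1)) * (W (j + 1) - W j).
Hypothesis v_lip : forall j, `|v j - v (j + 1)| <= L * `|W (j + 1) - W j|.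

Let rho' j := rho j + lam * (rho (j - 1) * v j - rho j * v (j + 1)).
Hypothesis rho'01 : forall j, 0 <= rho' j <= 1.
Let d k := g k - g k.+1.
Let c k := d k - d k.+1.
Let D j := W (j + 1) - W j.
Let b j := `|v j - v (j + 1)|.

Let g_ge0 k : 0 <= g k.
Proof. by case/andP: (g_noninc k) => *; lra. Qed.

Let d_ge0 k : 0 <= d k.
Proof. by rewrite /d; case/andP: (g_noninc k) => *; lra. Qed.

Let c_ge0 k : 0 <= c k.
Proof. by have := g_convex k; rewrite /c /d; lra. Qed.

Let rho_ge0 j : 0 <= rho j.
Proof. by case/andP: (rho01 j). Qed.

Let v_ge0 j : 0 <= v j.
Proof. by case/andP: (v0M j). Qed.

Let g0_le1 : g 0%N <= 1.
Proof. exact: weights0_le1. Qed.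

(* The updated nonlocal term is the limit of [W_update K j]: summation by parts
   moves the discrete derivative of the flux onto the weights.  Truncating at
   [K] keeps every later exchange of summations finite. *)
Let W_update K j := W j + lam * (v j * (W (j - 1) - W j)
  + \sum_(0 <= k < K) d k * rho (j + k%:Z) * (v j - v (j + k%:Z + 1))).

Let W_updateS K j : W_update K.+1 j =
  W_update K j + lam * (d K * rho (j + K%:Z) * (v j - v (j + K%:Z + 1))).
Proof. by rewrite /W_update big_nat_recr//=; ring. Qed.

Let W_update_cvg j : W_update ^~ j @ \oo --> nonlocal_term g rho' j.
Proof.
pose P i K := \sum_(0 <= k < K) g k * rho (i + k%:Z).
have cP i : P i @ \oo --> W i by exact: nonlocal_term_cvg.
pose r K := g K * (rho (j + K%:Z - 1) * (v j - v (j + K%:Z))).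
have r_cvg0 : r @ \oo --> (0 : R).
  have cgM (a : R) : g K * a @[K --> \oo] --> (0 : R).
    by rewrite -[X in _ --> X](mul0r a); apply: cvgMr_tmp; exact: weights_cvg0.
  apply: (@squeeze_cvgr _ _ _ _ (fun K => g K * (- M)) (fun K => g K * M)) => //.
  apply: nearW => K.
  have /andP[r0 r1] := rho01 (j + K%:Z - 1).
  have /andP[vj0 vjM] := v0M j; have /andP[vk0 vkM] := v0M (j + K%:Z).
  by apply/andP; split; apply: ler_wpM2l => //; nra.
have lim := nonlocal_term_cvg _ _ g_ge0 g_sum _ rho'01 j.
(* [W_update] contains the full sums [W] where the identity has the truncated [P]. The zero
   differences inserted here are the limits of the corrections [W - P]. *)
rewrite (_ : nonlocal_term _ _ _ = nonlocal_term g rho' j + (W j - W j)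
  + lam * (v j * ((W (j - 1) - W (j - 1)) - (W j - W j))) - lam * 0); last by ring.
apply: cvg_trans (cvgB (cvgD (cvgD lim (cvgB (cvg_cst (W j)) (cP j)))
  (cvgMl_tmp (a:=lam) (cvgMl_tmp (a:=v j)
    (cvgB (cvgB (cvg_cst (W (j - 1))) (cP (j - 1)))
     (cvgB (cvg_cst (W j)) (cP j)))))) (cvgMl_tmp (a:=lam) r_cvg0)).
apply: near_eq_cvg; apply: nearW => K.
rewrite /= !fctE /series/= flux_partial_sum /W_update /P /r /d; ring.
Qed.

(* Cutting off at [K] around [j + 1] but at [K.+1] around [j] aligns the cells,
   so that only the second differences [c k >= 0] of the weights remain. *)
Let D_update K j := (1 - lam * v (j + 1)) * D j + lam * v j * D (j - 1)
  + lam * \sum_(0 <= k < K) c k * rho (j + 1 + k%:Z)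
          * (v (j + 1) - v (j + 1 + k%:Z + 1))
  - lam * (v j - v (j + 1)) * \sum_(0 <= k < K.+1) d k * rho (j + k%:Z).

Let D_updateS K j : D_update K.+1 j = D_update K j
  + lam * (c K * rho (j + 1 + K%:Z) * (v (j + 1) - v (j + 1 + K%:Z + 1)))
  - lam * (v j - v (j + 1)) * (d K.+1 * rho (j + K.+1%:Z)).
Proof.
rewrite /D_update (big_nat_recr K)//= (big_nat_recr K.+1)//=; ring.
Qed.

Let D_updateE K j : W_update K (j + 1) - W_update K.+1 j = D_update K j.
Proof.
elim: K => [|K IH].
  rewrite /W_update /D_update !big_nat1 !big_nil /D !addr0 !addrK; ring.
rewrite D_updateS -IH (W_updateS K (j + 1)) (W_updateS K.+1 j).
have -> : j + K.+1%:Z = j + 1 + K%:Z by rewrite intS; ring.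
rewrite /c; ring.
Qed.

Let D_update_cvg j : D_update ^~ j @ \oo -->
  nonlocal_term g rho' (j + 1) - nonlocal_term g rho' j.
Proof.
have cS : W_update n.+1 j @[n --> \oo] --> nonlocal_term g rho' j.
  by rewrite (cvg_shiftS (W_update ^~ j)); exact: W_update_cvg.
apply: cvg_trans (cvgB (W_update_cvg (j + 1)) cS).
by apply: near_eq_cvg; apply: nearW => K; rewrite -D_updateE.
Qed.

Let S K j := \sum_(0 <= k < K) d k * rho (j + k%:Z).

Let S_ge0 K j : 0 <= S K j.
Proof. by apply: sumr_ge0 => k _; rewrite mulr_ge0. Qed.

Let S_le1 K j : S K j <= 1.
Proof.
(* The weights [d k] telescope to [g 0 - g K]; carrying [g K] along makes the bound inductive. *)
suff : S K j + g K <= g 0%N by move: g0_le1 (g_ge0 K); lra.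
elim: K => [|K IH]; first by rewrite /S big_nil add0r.
have dr : d K * rho (j + K%:Z) <= d K.
  by rewrite ler_piMr//; case/andP: (rho01 (j + K%:Z)).
rewrite /S big_nat_recr//= -/(S K j); move: IH dr; rewrite /d; lra.
Qed.

(** The CFL condition enters here: [v (j + 1) <= M], [b j <= L * |D j|] and [S K j <= 1] bound the
    subtracted terms by [lam * (M + L) * |D j|]. *)
Let f_ge0 K j : 0 <= (1 - lam * v (j + 1)) * `|D j| - lam * b j * S K j.
Proof.
have := v_lip j; rewrite -/(D j) -/(b j) => bL.
have /andP[_ vM] := v0M (j + 1).
have bS : b j * S K j <= b j by rewrite ler_piMr ?normr_ge0.
have h1 : lam * (b j * S K j) <= lam * (L * `|D j|).
  by rewrite ler_wpM2l// (le_trans bS).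
have h2 : lam * v (j + 1) * `|D j| <= lam * M * `|D j|.
  by rewrite ler_wpM2r// ler_wpM2l.
have h3 : lam * (M + L) * `|D j| <= 1 * `|D j| by rewrite ler_wpM2r.
move: (`|D j|) h1 h2 h3 => x; lra.
Qed.

Let v_telescope m n : `|v m - v (m + n%:Z)| <= \sum_(0 <= i < n) b (m + i%:Z).
Proof.
elim: n => [|n IH]; first by rewrite big_nil addr0 subrr normr0.
rewrite big_nat_recr//= (le_trans _ (lerD IH (lexx _)))//.
rewrite (le_trans _ (ler_normD _ _))// (_ : m + n.+1%:Z = m + n%:Z + 1).
  by rewrite addrA subrK.
by rewrite intS; ring.
Qed.

Let D_update_le K j : `|D_update K j| <=
  ((1 - lam * v (j + 1)) * `|D j| - lam * b j * S K.+1 j)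
  + lam * v j * `|D (j - 1)|
  + \sum_(0 <= k < K) \sum_(0 <= i < k.+1)
       lam * c k * rho (j + 1 + k%:Z) * b (j + 1 + i%:Z).
Proof.
(* The terms in [D j] and in [v j - v (j + 1)] are grouped: these factors have the same sign, so
   [normrB_same_sign] retains the negative term that later absorbs the double sum. *)
rewrite (_ : D_update K j = ((1 - lam * v (j + 1)) * D j
    - (lam * S K.+1 j) * (v j - v (j + 1))) + lam * v j * D (j - 1)
  + \sum_(0 <= k < K) lam * (c k * rho (j + 1 + k%:Z)
      * (v (j + 1) - v (j + 1 + k%:Z + 1)))); last first.
  by rewrite /D_update -mulr_sumr /S; ring.
apply: le_trans (ler_normD _ _) _; apply: lerD.
  apply: le_trans (ler_normD _ _) _; apply: lerD.
    have f0 := f_ge0 K.+1 j.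
    have E : lam * b j * S K.+1 j = lam * S K.+1 j * `|v j - v (j + 1)|.
      by rewrite mulrAC.
    rewrite E in f0 *; rewrite (normrB_same_sign _ _ _ _ _ (v_sign j) f0)//
      ?mulr_ge0//.
    have /andP[_ vM] := v0M (j + 1).
    move: (ler_wpM2l lam_ge0 vM) (mulr_ge0 lam_ge0 L_ge0) lamLM; lra.
  by rewrite normrM ger0_norm// mulr_ge0.
apply: le_trans (ler_norm_sum _ _ _) _; apply: ler_sum => k _.
rewrite mulrA normrM ger0_norm ?mulr_ge0// mulrA -mulr_sumr.
rewrite ler_wpM2l ?mulr_ge0//.
have := v_telescope (j + 1) k.+1.
by rewrite (_ : j + 1 + k.+1%:Z = j + 1 + k%:Z + 1)// intS; ring.
Qed.

(** All summands are nonnegative, so sums may be split and shifted even when infinite. After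
    shifting, [|D j|] receives the weights [1 - lam * v (j + 1)] and [lam * v (j + 1)], of sum 1,
    and the double sum is absorbed by [- lam * b j * S K.+1 j]. *)
Lemma nonlocal_variation_update_le :
  (\esum_(j in [set: int])
      `|nonlocal_term g rho' (j + 1) - nonlocal_term g rho' j|%:E
   <= \esum_(j in [set: int]) `|W (j + 1) - W j|%:E)%E.
Proof.
apply: (esum_cvg_le _ _ _ D_update) => [j|K]; first exact: D_update_cvg.
pose f j := (1 - lam * v (j + 1)) * `|D j| - lam * b j * S K.+1 j.
have fj_ge0 j : 0 <= f j by exact: f_ge0.
pose e k i j := lam * c k * rho (j + 1 + k%:Z) * b (j + 1 + i%:Z).
have e_ge0 k i j : 0 <= e k i j by rewrite /e !mulr_ge0 ?normr_ge0.
have vD_ge0 j : 0 <= lam * v j * `|D (j - 1)| by rewrite !mulr_ge0.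
apply: (@le_trans _ _ (\esum_(j in [set: int]) ((f j)%:E
    + (lam * v j * `|D (j - 1)|)%:E
    + \sum_(0 <= k < K) \sum_(0 <= i < k.+1) (e k i j)%:E))%E).
  apply: le_esum => j _.
  under eq_bigr do rewrite sumEFin.
  rewrite sumEFin -!EFinD lee_fin; exact: D_update_le.
have sum_e_ge0 k j : (0 <= \sum_(0 <= i < k.+1) (e k i j)%:E)%E.
  by apply: sume_ge0 => i _; rewrite lee_fin.
rewrite esumD; last 2 first.
- by move=> j _; rewrite -EFinD lee_fin addr_ge0.
- by move=> j _; apply: sume_ge0 => k _.
rewrite esumD; last 2 first.
- by move=> j _; rewrite lee_fin.
- by move=> j _; rewrite lee_fin.
rewrite [X in (_ + X + _)%E](esum_shift _ _ 1).
rewrite esum_sum; last by [].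
(* The term of index [(k, i)] is shifted by [i + 1], so that all of them carry the same factor
   [b j]. *)
rewrite (eq_bigr (fun k => \esum_(j in [set: int])
    \sum_(0 <= i < k.+1) (e k i (j - 1 - i%:Z))%:E)%E); last first.
  move=> k _; rewrite !esum_sum; [|by move=> *; rewrite lee_fin..].
  apply: eq_bigr => i _.
  rewrite [RHS](esum_shift _ _ (i%:Z + 1)); apply: eq_esum => j _.
  by congr (e k i _)%:E; ring.
have sum_e'_ge0 k j : (0 <= \sum_(0 <= i < k.+1) (e k i (j - 1 - i%:Z))%:E)%E.
  by apply: sume_ge0 => i _; rewrite lee_fin.
rewrite -esum_sum; last by [].
rewrite -esumD; last 2 first.
- by move=> j _; rewrite lee_fin.
- by move=> j _; rewrite lee_fin.
rewrite -esumD; last 2 first.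
- by move=> j _; rewrite -EFinD lee_fin addr_ge0.
- by move=> j _; apply: sume_ge0 => k _.
apply: le_esum => j _.
under eq_bigr do rewrite sumEFin.
rewrite sumEFin -!EFinD lee_fin addrK.
rewrite (_ : \sum_(0 <= k < K) _ = lam * b j *
    \sum_(0 <= k < K) c k * \sum_(0 <= i < k.+1) rho (j + i%:Z)); last first.
  rewrite mulr_sumr; apply: eq_bigr => k _.
  rewrite big_nat_rev/= !mulr_sumr; apply: eq_big_nat => i /andP[_ ik].
  rewrite /e add0n subSS -subzn//.
  have -> : j - 1 - (k%:Z - i%:Z) + 1 + k%:Z = j + i%:Z by ring.
  have -> : j - 1 - (k%:Z - i%:Z) + 1 + (k%:Z - i%:Z) = j by ring.
  by ring.
have -> : `|W (j + 1) - W j| = `|D j| by [].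
(* By [convex_weights_sum] the left side is [S K j] minus a nonnegative boundary term. *)
have SK : \sum_(0 <= k < K) c k * \sum_(0 <= i < k.+1) rho (j + i%:Z) <= S K.+1 j.
  rewrite /S big_nat_recr//= -(convex_weights_sum _ d) -addrA lerDl.
  by rewrite addr_ge0 ?mulr_ge0// sumr_ge0.
have : 0 <= lam * b j by rewrite mulr_ge0 ?normr_ge0.
move=> /ler_wpM2l /(_ _ _ SK); rewrite /f; lra.
Qed.
End variation_diminishing.

(** * Maximum principle and iteration in time *)

Section scheme.
Context (R : realType) (g : R^nat) (h tau L M : R) (rho0 V : R -> R).
Hypothesis g_noninc : forall k, 0 <= g k.+1 <= g k.
Hypothesis g_sum : series g @ \oo --> (1 : R).
Hypotheses (lam_ge0 : 0 <= tau / h) (L_ge0 : 0 <= L).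
Hypothesis lamLM : tau / h * (M + L) <= 1.
Hypothesis V_bound : forall x, 0 <= x <= 1 -> 0 <= V x <= M.
Hypothesis V_slope : forall x y, 0 <= x -> x <= y -> y <= 1 ->
  0 <= V x - V y <= L * (y - x).
Hypothesis avg01 : forall j, 0 <= cell_average h rho0 j <= 1.

Let g_ge0 k : 0 <= g k.
Proof. by case/andP: (g_noninc k) => *; lra. Qed.

Let g0_le1 : g 0%N <= 1.
Proof. exact: weights0_le1. Qed.

(** Summation by parts moves the difference onto the nonincreasing weights; then [rho <= 1] is used
    in every cell but [j]. The factor [1 - rho j] is what the upper bound of the maximum principle
    needs. *)
Lemma nonlocal_term_increment_le (rho : int -> R) j :
  (forall i, 0 <= rho i <= 1) ->
  nonlocal_term g rho (j + 1) - nonlocal_term g rho j <= g 0%N * (1 - rho j).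
Proof.
move=> rho01; have cD := nonlocal_term_shift_sub _ _ g_ge0 g_sum _ rho01 j.
rewrite -(cvg_lim _ cD)//; apply: limr_le; first exact: cvgP cD.
apply: nearW => n.
(* The remainder at [n] is kept to make the bound inductive. *)
suff : \sum_(0 <= k < n) g k * (rho (j + 1 + k%:Z) - rho (j + k%:Z))
    <= g 0%N * (1 - rho j) - g n * (1 - rho (j + n%:Z)).
  have : 0 <= g n * (1 - rho (j + n%:Z)).
    by rewrite mulr_ge0// subr_ge0; case/andP: (rho01 (j + n%:Z)).
  lra.
elim: n => [|n IH]; first by rewrite big_nil addr0; lra.
rewrite big_nat_recr//= (_ : j + n.+1%:Z = j + 1 + n%:Z); last by rewrite intS; ring.
have /andP[_ r1] := rho01 (j + 1 + n%:Z); have /andP[_ gn] := g_noninc n.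
have : (g n - g n.+1) * (1 - rho (j + 1 + n%:Z)) >= 0 by rewrite mulr_ge0// subr_ge0.
lra.
Qed.

(** Below: the outflow removes at most a fraction [lam * M <= 1] of [rho j]. Above: the worst inflow
    has [rho (j - 1) = 1], and then the growth is at most [(1 - rho j) * (lam * L + lam * V (W (j +
    1)))], hence at most [1 - rho j]. *)
Lemma scheme_step01 (rho : int -> R) j : (forall i, 0 <= rho i <= 1) ->
  0 <= rho j + tau / h * (rho (j - 1) * V (nonlocal_term g rho j)
                          - rho j * V (nonlocal_term g rho (j + 1))) <= 1.
Proof.
move=> rho01; set W := nonlocal_term g rho.
have W01 i : 0 <= W i <= 1 by exact: nonlocal_term01.
have /andP[V0 VM] := V_bound _ (W01 j).
have /andP[V0' VM'] := V_bound _ (W01 (j + 1)).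
have /andP[r0 r1] := rho01 j; have /andP[s0 s1] := rho01 (j - 1).
move: lam_ge0 lamLM; set lam := tau / h => l0 l1.
have lM : lam * M <= 1 - lam * L by lra.
have lL : 0 <= lam * L by rewrite mulr_ge0.
have lV : lam * V (W (j + 1)) <= lam * M by rewrite ler_wpM2l.
have lV0 : 0 <= lam * (rho (j - 1) * V (W j)) by rewrite mulr_ge0 // mulr_ge0.
apply/andP; split.
  have : 0 <= rho j * (1 - lam * V (W (j + 1))) by rewrite mulr_ge0//; lra.
  lra.
have dV : V (W j) - V (W (j + 1)) <= L * (1 - rho j).
  have /andP[W0 W1] := W01 j; have /andP[W0' W1'] := W01 (j + 1).
  have [le|/ltW le] := leP (W j) (W (j + 1)).
    have /andP[_ /le_trans->//] := V_slope _ _ W0 le W1'.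
    rewrite ler_wpM2l// (le_trans (nonlocal_term_increment_le _ _ rho01))//.
    by rewrite ler_piMl// subr_ge0.
  have /andP[dV _] := V_slope _ _ W0' le W1.
  by have := mulr_ge0 L_ge0 (_ : 0 <= 1 - rho j); lra.
have h1 : lam * (V (W j) - V (W (j + 1))) <= lam * (L * (1 - rho j)).
  by rewrite ler_wpM2l.
have h2 : lam * (rho (j - 1) * V (W j)) <= lam * V (W j).
  by rewrite ler_wpM2l// ler_piMl.
have h3 : 0 <= (1 - rho j) * (1 - lam * L - lam * V (W (j + 1))).
  by rewrite mulr_ge0//; lra.
lra.
Qed.

Lemma scheme_rho01 n j : 0 <= scheme_rho V g h tau rho0 n j <= 1.
Proof.
elim: n j => [|n IH] j; first exact: avg01.
exact: scheme_step01.
Qed.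

Hypothesis g_convex : forall k, g k.+1 - g k.+2 <= g k - g k.+1.

Let W := scheme_W V g h tau rho0.

Lemma scheme_variation_noninc n :
  (\esum_(j in [set: int]) `|W n.+1 (j + 1) - W n.+1 j|%:E
   <= \esum_(j in [set: int]) `|W n (j + 1) - W n j|%:E)%E.
Proof.
set rho := scheme_rho V g h tau rho0 n.
have rho01 i : 0 <= rho i <= 1 by exact: scheme_rho01.
have W01 i : 0 <= W n i <= 1 by exact: nonlocal_term01.
pose v j := V (W n j).
apply: (nonlocal_variation_update_le _ g (tau / h) L M rho v) => //.
- by move=> j; exact: V_bound.
- move=> j; rewrite -/(W n) /v.
  have /andP[W0 W1] := W01 j; have /andP[W0' W1'] := W01 (j + 1).
  have [le|/ltW le] := leP (W n j) (W n (j + 1)).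
    by rewrite mulr_ge0 ?subr_ge0//; have /andP[] := V_slope _ _ W0 le W1'; lra.
  rewrite mulr_le0 ?subr_le0//; have /andP[] := V_slope _ _ W0' le W1; lra.
- move=> j; rewrite -/(W n) /v.
  have /andP[W0 W1] := W01 j; have /andP[W0' W1'] := W01 (j + 1).
  have [le|/ltW le] := leP (W n j) (W n (j + 1)).
    have /andP[? ?] := V_slope _ _ W0 le W1'.
    by rewrite !ger0_norm// subr_ge0.
  have /andP[? ?] := V_slope _ _ W0' le W1.
  by rewrite distrC (distrC (W n _)) !ger0_norm// subr_ge0.
- exact: (scheme_rho01 n.+1).
Qed.

Lemma scheme_variation_le n :
  (\esum_(j in [set: int]) `|W n (j + 1) - W n j|%:E
   <= \esum_(j in [set: int])
        `|cell_average h rho0 (j + 1) - cell_average h rho0 j|%:E)%E.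
Proof.
elim: n => [|n IH]; first exact: nonlocal_term_variation_le.
exact: le_trans (scheme_variation_noninc n) IH.
Qed.
End scheme.

(** * Cell averages *)

Lemma lebesgue_measure_itv_cc_lty (R : realType) (a b : R) :
  (@lebesgue_measure R `[a, b] < +oo)%E.
Proof.
by rewrite lebesgue_measure_itv/=; case: ifP => _; rewrite ?ltry// -EFinB ltry.
Qed.

Lemma lebesgue_measure_itv_cc (R : realType) (a b : R) : a <= b ->
  @lebesgue_measure R `[a, b] = (b - a)%:E.
Proof.
rewrite lebesgue_measure_itv/= lte_fin le_eqVlt => /predU1P[->|->//].
by rewrite ltxx subrr.
Qed.

Lemma Rintegral_cst_itv_cc (R : realType) (a b r : R) : a <= b ->
  \int[@lebesgue_measure R]_(x in `[a, b]) r = r * (b - a).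
Proof.
move=> ab; rewrite Rintegral_cst//; congr (_ * _).
exact: (congr1 fine (lebesgue_measure_itv_cc _ _ _ ab)).
Qed.

Lemma integrable_cst_itv_cc (R : realType) (a b r : R) :
  (@lebesgue_measure R).-integrable `[a, b] (EFin \o cst r).
Proof.
apply: measurable_bounded_integrable => //.
- exact: lebesgue_measure_itv_cc_lty.
- by exists `|r|; split => // x rx y _ /=; exact: ltW.
Qed.

Lemma integrableZl_itv_cc (R : realType) (a b c : R) (f : R -> R) :
  (@lebesgue_measure R).-integrable `[a, b] (EFin \o f) ->
  (@lebesgue_measure R).-integrable `[a, b] (EFin \o (fun x => c * f x)).
Proof.
move=> fi; apply: (@eq_integrable _ _ _ lebesgue_measure _ _
  (fun x => c%:E * (EFin \o f) x)%E) => //.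
exact: integrableZl.
Qed.

Lemma ae_neq (R : realType) (d : R) : \forall x \ae @lebesgue_measure R, x <> d.
Proof.
exists [set d]; split => //; first exact: lebesgue_measure_set1.
by move=> x /= /contrapT.
Qed.

(** * Averages of functions with values in the unit interval *)

Section unit_valued.
Context (R : realType) (f : R -> R).
Hypotheses (mf : measurable_fun [set: R] f) (f01 : forall x, 0 <= f x <= 1).
Local Notation mu := (@lebesgue_measure R).

Lemma integrable_itv_cc01 (a b : R) : mu.-integrable `[a, b] (EFin \o f).
Proof.
apply: measurable_bounded_integrable => //.
- exact: lebesgue_measure_itv_cc_lty.
- exact: measurable_funTS.
- exists 1; split => // x x1 y _ /=; case/andP: (f01 y) => f0 f1.
  by rewrite ger0_norm//; lra.
Qed.

Lemma average01 (a b : R) : a < b ->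
  0 <= (b - a)^-1 * \int[mu]_(x in `[a, b]) f x <= 1.
Proof.
move=> ab; apply/andP; split.
  rewrite mulr_ge0 ?invr_ge0 ?subr_ge0 ?(ltW ab)//; apply: Rintegral_ge0 => x _.
  by case/andP: (f01 x).
rewrite mulrC ler_pdivrMr ?subr_gt0// mul1r.
rewrite -[leRHS]mul1r -(Rintegral_cst_itv_cc _ _ _ _ (ltW ab)).
apply: le_Rintegral => //.
- exact: integrable_itv_cc01.
- exact: integrable_cst_itv_cc.
- by move=> x _; case/andP: (f01 x).
Qed.

(** Otherwise [c * m - c * f], of integral zero, would be positive almost everywhere on an interval
    of positive length. The sign of [c] selects whether [f x] lies above or below the mean. *)
Lemma average_le_point (a b c : R) (P : R -> Prop) : a < b ->
  (\forall x \ae mu, P x) ->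
  exists x, [/\ a < x < b, P x &
    c * ((b - a)^-1 * \int[mu]_(x in `[a, b]) f x) <= c * f x].
Proof.
move=> ab aeP; set m := _^-1 * _.
have muD := lebesgue_measure_itv_cc _ _ _ (ltW ab).
apply: contrapT => H.
pose phi x := c * m - c * f x.
have intcf : mu.-integrable `[a, b] (EFin \o (fun x => c * f x)).
  by apply: integrableZl_itv_cc; exact: integrable_itv_cc01.
have intphi : mu.-integrable `[a, b] (EFin \o phi).
  exact: (integrableB _ (integrable_cst_itv_cc _ _ _ (c * m)) intcf).
have phi_gt0 : \forall x \ae mu, `[a, b]%classic x -> 0 < phi x.
  move: aeP (ae_neq _ a) (ae_neq _ b); apply: filterS3.
    exact: (ae_filter_ringOfSetsType mu).
  move=> x Px xa xb /=; rewrite in_itv/=.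
  move=> /andP[]; rewrite le_eqVlt => /orP[/eqP/esym//|ax].
  rewrite le_eqVlt => /orP[/eqP//|xb'].
  rewrite subr_gt0 ltNge; apply/negP => h; apply: H; exists x.
  by rewrite ax xb'.
have int0 : (\int[mu]_(x in `[a, b]) `|(phi x)%:E| = 0)%E.
  rewrite (@ae_eq_integral _ _ _ mu _ (EFin \o phi)) => //.
  - rewrite -[LHS]fineK ?integrable_fin_num//; congr EFin.
    transitivity (\int[mu]_(x in `[a, b]) (c * m - c * f x)) => //.
    rewrite RintegralB//; last exact: integrable_cst_itv_cc.
    rewrite [X in X - _](Rintegral_cst_itv_cc _ _ _ _ (ltW ab)).
    rewrite RintegralZl//; last exact: integrable_itv_cc01.
    by rewrite /m; field; rewrite subr_eq0 gt_eqF.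
  - exact: (measurable_int _ (integrable_abse intphi)).
  - exact: (measurable_int _ intphi).
  - move: phi_gt0; apply: filterS; first exact: (ae_filter_ringOfSetsType mu).
    by move=> x h Dx; rewrite /= gtr0_norm// h.
have phi0 : ae_eq mu `[a, b]%classic (EFin \o phi) (cst 0%E).
  by apply/ae_eq_integral_abs => //; exact: (measurable_int _ intphi).
have : \forall x \ae mu, ~ `[a, b]%classic x.
  move: phi_gt0 phi0; apply: filterS2; first exact: (ae_filter_ringOfSetsType mu).
  move=> x h1 h2 Dx.
  by have := h1 Dx; have := h2 Dx; move=> [->]; rewrite ltxx.
move=> [N [mN N0 sN]].
have : (mu `[a, b] <= mu N)%E.
  by apply: le_measure; rewrite ?inE// => x Dx; apply: sN => /=; apply.
by rewrite N0 muD lee_fin subr_le0 leNgt ab.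
Qed.

End unit_valued.

(** Extending [s] by zero on the left and asking for [s n = 0] on the right removes both boundary
    terms. *)
Lemma summation_by_parts (R : comRingType) (s u : nat -> R) (n : nat) :
  s n = 0 ->
  \sum_(0 <= i < n) s i * (u i.+1 - u i) =
  \sum_(0 <= i < n.+1) ((if i is k.+1 then s k else 0) - s i) * u i.
Proof.
move=> sn0; under eq_bigr do rewrite mulrBr.
under [RHS]eq_bigr do rewrite mulrBl.
rewrite !sumrB [in RHS]big_nat_recl//= mul0r add0r.
by congr (_ - _); rewrite big_nat_recr//= sn0 mul0r addr0.
Qed.

Lemma sum_le_pointwise_TV (R : realType) (g : R -> R) (x : nat -> R) n :
  (forall i, x i < x i.+1) ->
  ((\sum_(0 <= i < n) `|g (x i.+1) - g (x i)|)%:E <= pointwise_TV g)%E.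
Proof.
move=> x_incr; pose s := [seq x i.+1 | i <- iota 0 n].
have nth_s i : (i <= n)%N -> nth (x n) (x 0%N :: s) i = x i.
  by case: i => //= i ltin; rewrite (nth_map 0%N) ?size_iota// nth_iota.
apply: (@le_trans _ _ (total_variation (x 0%N) (x n) g)); last first.
  by apply: ereal_sup_ubound; exists (x 0%N, x n).
apply: ereal_sup_ubound; exists (variation (x 0%N) (x n) g s).
  exists s => //; split.
    have : forall m, path <%R (x m) [seq x i.+1 | i <- iota m n].
      by rewrite /s; elim: n {s nth_s} => //= n IH m; rewrite x_incr IH.
    exact.
  by rewrite (last_nth (x n)) size_map size_iota nth_s.
congr EFin; rewrite /variation size_map size_iota.
apply: eq_big_nat => i /andP[_ ltin].
by rewrite /comp (nth_s i.+1 ltin) (nth_s i (ltnW ltin)).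
Qed.

(** A finite set of integers lies in a symmetric window from [- N] to [N], which has [2 N + 1]
    elements. *)
Lemma esum_int_le (R : realType) (a : int -> R) (T : \bar R) :
  (forall j, 0 <= a j) ->
  (forall m n, ((\sum_(0 <= i < n) a (m + i%:Z))%:E <= T)%E) ->
  (\esum_(j in [set: int]) (a j)%:E <= T)%E.
Proof.
move=> a0 aT; apply: ge_ereal_sup => _ [X [finX _] <-].
have /finite_seqP[r rX] := finX.
pose N := \max_(x <- r) `|x|%N.
have le_N x : x \in r -> (`|x| <= N)%N by move=> xr; exact: leq_bigmax_seq.
pose e (i : nat) : int := - N%:Z + i%:Z.
apply: le_trans (aT (- N%:Z) N.*2.+1).
rewrite -sumEFin big_mkord (@fsbig_ord _ _ _ _ (fun i => (a (e i))%:E)).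
rewrite -(@fsbig_image _ _ _ _ _ `I_(N.*2.+1) e (fun j => (a j)%:E)); last first.
  by move=> i k _ _ /addrI [].
apply: lee_fsum_nneg_subset => //.
- exact: finite_image.
- move=> x; rewrite !inE rX /= => /le_N xN; exists (absz (x + N%:Z)) => /=; last first.
    rewrite /e; lia.
  lia.
- by move=> x _; rewrite lee_fin.
Qed.

Section cell_average.
Context (R : realType) (h : R) (f : R -> R).
Hypothesis h_gt0 : 0 < h.
Local Notation mu := (@lebesgue_measure R).

Let cell (j : int) := ((j%:~R - 2^-1) * h, (j%:~R + 2^-1) * h) : R * R.

Let cell_lt j : (cell j).1 < (cell j).2.
Proof. by rewrite /cell/= ltr_pM2r//; lra. Qed.

Let cell_length j : (cell j).2 - (cell j).1 = h.
Proof. by rewrite /cell/=; field. Qed.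

Hypotheses (mf : measurable_fun [set: R] f) (f01 : forall x, 0 <= f x <= 1).

Lemma cell_average01 j : 0 <= cell_average h f j <= 1.
Proof. by have := average01 _ _ mf f01 _ _ (cell_lt j); rewrite cell_length. Qed.

(* Summing by parts, the variation of the averages is a linear combination of
   them with coefficients [c i]; replacing the average on each cell by a value of
   [g] at a point [x i] chosen according to the sign of [c i] only increases it. *)
Lemma cell_average_window_le (g : R -> R) (m : int) (n : nat) :
  (\forall x \ae mu, g x = f x) ->
  ((\sum_(0 <= i < n) `|cell_average h f (m + i%:Z + 1)
      - cell_average h f (m + i%:Z)|)%:E <= pointwise_TV g)%E.
Proof.
move=> gf; pose a i := cell_average h f (m + i%:Z).
(* The sign turns each modulus into a linear expression; the value 0 from [n] on is the boundary
   condition of [summation_by_parts]. *)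
pose s i := if (i < n)%N then Num.sg (a i.+1 - a i) else 0.
pose c i := (if i is k.+1 then s k else 0) - s i.
have /choice[x xP] i : exists x, [/\ (cell (m + i%:Z)).1 < x < (cell (m + i%:Z)).2,
    g x = f x & c i * a i <= c i * f x].
  have := average_le_point _ _ mf f01 _ _ (c i) _ (cell_lt (m + i%:Z)) gf.
  by rewrite cell_length.
have x_incr i : x i < x i.+1.
  have [/andP[_ xi] _ _] := xP i; have [/andP[xi' _] _ _] := xP i.+1.
  apply: lt_trans xi (le_lt_trans _ xi').
  rewrite /cell/= intS ler_pM2r// (_ : m + (1 + i%:Z) = m + i%:Z + 1); last by ring.
  rewrite (intrD _ (m + i%:Z)) /=; lra.
apply: le_trans (sum_le_pointwise_TV _ _ _ n x_incr); rewrite lee_fin.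
have sn : s n = 0 by rewrite /s ltnn.
have := summation_by_parts _ _ a _ sn.
have := summation_by_parts _ _ (g \o x) _ sn => /= Eg Ea.
apply: (@le_trans _ _ (\sum_(0 <= i < n) s i * (a i.+1 - a i))).
  rewrite big_nat [leRHS]big_nat; apply: ler_sum => i /andP[_ ltin].
  by rewrite /s ltin -normrEsg /a intS addrCA [1 + _]addrC.
rewrite Ea; apply: (@le_trans _ _ (\sum_(0 <= i < n) s i * (g (x i.+1) - g (x i)))).
  rewrite Eg; apply: ler_sum => i _; have [_ -> ] := xP i; exact.
apply: ler_sum => i _; rewrite /s; case: ifP => _; last by rewrite mul0r.
apply: le_trans (ler_norm _) _; rewrite normrM normr_sg.
by case: (_ == 0); rewrite ?mul0r ?mul1r.
Qed.

End cell_average.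

Lemma eq_cell_average (R : realType) (h : R) (f g : R -> R) (j : int) :
  measurable_fun [set: R] f -> measurable_fun [set: R] g ->
  (\forall x \ae @lebesgue_measure R, f x = g x) ->
  cell_average h f j = cell_average h g j.
Proof.
move=> mf mg fg; congr (_ * fine _); apply: ae_eq_integral => //.
- by apply/measurable_EFinP; exact: measurable_funTS.
- by apply/measurable_EFinP; exact: measurable_funTS.
- move: fg; apply: filterS.
    exact: (ae_filter_ringOfSetsType lebesgue_measure).
  by move=> x /= ->.
Qed.

Section cell_average_ae.
Context (R : realType) (h : R) (f : R -> R).
Hypotheses (h_gt0 : 0 < h) (mf : measurable_fun [set: R] f).
Hypothesis f01 : \forall x \ae @lebesgue_measure R, 0 <= f x <= 1.

(** A representative of [f] for which the bounds hold everywhere; cell averages do not distinguish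
    the two. *)
Let f1 := (fun x => Num.max 0 (Num.min (f x) 1)).

Let mf1 : measurable_fun [set: R] f1.
Proof. by apply: measurable_maxr => //; apply: measurable_minr. Qed.

Let f1_01 x : 0 <= f1 x <= 1.
Proof. by rewrite /f1 le_max lexx ge_max ler01 ge_min lexx orbT. Qed.

Let f_eq : \forall x \ae @lebesgue_measure R, f x = f1 x.
Proof.
move: f01; apply: filterS.
    exact: (ae_filter_ringOfSetsType lebesgue_measure).
by move=> x /andP[fx0 fx1]; rewrite /f1 min_l// max_r.
Qed.

Lemma cell_average01_ae j : 0 <= cell_average h f j <= 1.
Proof. by rewrite (eq_cell_average _ _ _ _ _ mf mf1 f_eq); exact: cell_average01. Qed.

(** [TV f] is an infimum over representatives, and the window bound holds for each of them with the
    same averages. *)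
Lemma cell_average_variation_le :
  (\esum_(j in [set: int]) `|cell_average h f (j + 1) - cell_average h f j|%:E
   <= TV f)%E.
Proof.
apply: le_ereal_inf_tmp => _ [g gf <-].
apply: (esum_int_le _ (fun j => `|cell_average h f (j + 1) - cell_average h f j|)).
  by [].
move=> m n.
under eq_bigr do rewrite !(eq_cell_average _ _ _ _ _ mf mf1 f_eq).
apply: cell_average_window_le => //.
move: gf f_eq; apply: filterS2.
  exact: (ae_filter_ringOfSetsType lebesgue_measure).
by move=> x <- //.
Qed.
End cell_average_ae.

(** * Lipschitz functions *)

(** Both measures come from covers by half-open intervals, and the [G]-length of an interval is at
    most [c] times its length; so a cover of total length below [e / c] has [G]-length at most
    [e]. *)
Lemma lipschitz_lebesgue_stieltjes_dominated (R : realType)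
    (G : cumulative R R) (c : R) : 0 < c ->
  (forall x y, x <= y -> G y - G x <= c * (y - x)) ->
  lebesgue_stieltjes_measure G `<< @lebesgue_measure R.
Proof.
move=> c0 Gc; apply/null_content_dominatesP => A mA A0.
apply/eqP; rewrite eq_le measure_ge0 andbT; apply/lee_addgt0Pr => e e0; rewrite add0e.
pose S := [set \sum_(0 <= k <oo) wlength idfun (C k) |
    C in measurable_cover (A : set (ocitv_type R))]%E.
(* Lebesgue measure unfolds by conversion to this infimum over countable covers. *)
have S0 : ereal_inf S = 0%E := A0.
have : (ereal_inf S < (e / c)%:E)%E by rewrite S0 lte_fin divr_gt0.
move=> /ereal_inf_lt[_ [C covC <-] Ce].
apply: (@le_trans _ _ (\sum_(0 <= k <oo) wlength G (C k))%E).
  by apply: ereal_inf_lbound; exists C.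
apply: (@le_trans _ _ (\sum_(0 <= k <oo) c%:E * wlength idfun (C k))%E).
  apply: lee_nneseries => [k _ _|k _]; first exact: wlength_ge0.
  have [[a b] _ /= <-] := covC.1 k.
  have [ab|ba] := leP a b; first by rewrite !wlength_itv_bnd//= lee_fin Gc.
  by rewrite set_itv_ge ?bnd_simp -?leNgt ?(ltW ba)// !wlength0 mule0.
rewrite nneseriesZl; last by move=> k _; exact: wlength_ge0.
rewrite (_ : e = c * (e / c)); last by rewrite mulrC divfK// gt_eqF.
by rewrite EFinM lee_wpmul2l ?lee_fin ?(ltW c0) ?(ltW Ce).
Qed.

Lemma lipschitz_cumulative_density (R : realType)
    (G : cumulativeBounded (0 : R) (1 : R)) (c : R) : 0 < c ->
  (forall x y, x <= y -> G y - G x <= c * (y - x)) ->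
  exists f : R -> R,
    (@lebesgue_measure R).-integrable [set: R] (EFin \o f) /\
    forall x y, x <= y -> G y - G x = \int[lebesgue_measure]_(t in `]x, y]) f t.
Proof.
move=> c0 Gc.
have [f [_ f_fin f_int fE]] := radon_nikodym_sigma_finite
  (lipschitz_lebesgue_stieltjes_dominated _ _ _ c0 Gc).
exists (fine \o f); split.
  by apply: eq_integrable f_int => // x _; rewrite /= fineK.
move=> x y xy; rewrite /Rintegral.
under eq_integral do rewrite /= fineK//.
rewrite -fE//=.
have -> : lebesgue_stieltjes_measure G `]x, y]%classic = wlength G `]x, y]%classic.
  by apply: measurable_mu_extE; exact: is_ocitv.
by rewrite wlength_itv_bnd.
Qed.

(** * Fundamental theorem of calculus for Lipschitz functions *)

Section lipschitz_FTC.
Context (R : realType) (V : R -> R) (K a b : R).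
Hypotheses (K_ge0 : 0 <= K) (ab : a < b).
Hypothesis V_lip : forall x y, a <= x -> x <= y -> y <= b ->
  `|V y - V x| <= K * (y - x).

(* [G] is [V + (K + 1) id] on [[a, b]], extended by constants and normalised to
   a cumulative distribution function; the slope [K + 1] instead of [K] makes
   the normalising constant [D] positive. *)
Let clamp x := Num.max a (Num.min x b).
Let D := V b - V a + (K + 1) * (b - a).
Let G x := (V (clamp x) - V a + (K + 1) * (clamp x - a)) / D.

Let D_gt0 : 0 < D.
Proof.
have := V_lip _ _ (lexx a) (ltW ab) (lexx b).
by rewrite ler_norml => /andP[h _]; move: ab h; rewrite /D; lra.
Qed.

Let clamp_ge x : a <= clamp x.
Proof. by rewrite /clamp le_max lexx. Qed.

Let clamp_le x : clamp x <= b.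
Proof. by rewrite /clamp ge_max (ltW ab) ge_min lexx orbT. Qed.

Let clampE x : a <= x -> x <= b -> clamp x = x.
Proof. by move=> ax xb; rewrite /clamp min_l// max_r. Qed.

Let clamp_nd x y : x <= y -> clamp x <= clamp y <= clamp x + (y - x).
Proof.
have := ab; move=> ab' xy; rewrite /clamp !maxEle !minEle.
by case: (leP x b) => ?; case: (leP y b) => ?; case: (leP a x) => ?;
  case: (leP a y) => ?; case: (leP a b) => ?; apply/andP; split; lra.
Qed.

(** The slopes of [V] lie between [- K] and [K], so those of [V + (K + 1) id] lie between 1 and
    [2 K + 1], and [clamp] does not increase distances. *)
Let G_slope x y : x <= y -> 0 <= G y - G x <= ((2 * K + 1) / D) * (y - x).
Proof.
have K0 := K_ge0; move=> /clamp_nd /andP[xy xy'].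
have := V_lip _ _ (clamp_ge x) xy (clamp_le y).
rewrite ler_norml => /andP[h1 h2].
rewrite -mulrBl; apply/andP; split.
  rewrite divr_ge0 ?(ltW D_gt0)//; lra.
rewrite [leRHS]mulrAC ler_pM2r ?invr_gt0//.
have : (2 * K + 1) * (clamp y - clamp x) <= (2 * K + 1) * (y - x).
  by rewrite ler_wpM2l//; lra.
lra.
Qed.

Let G_nd : nondecreasing G.
Proof. by move=> x y /G_slope /andP[+ _]; rewrite subr_ge0. Qed.

Let c_gt0 : 0 < (2 * K + 1) / D.
Proof. by have K0 := K_ge0; rewrite divr_gt0//; lra. Qed.

Let G_continuous : continuous G.
Proof.
move=> x; apply/cvgrPdist_lt => e e0; near=> y.
have xy : `|x - y| < e / ((2 * K + 1) / D).
  near: y; apply/nbhs_ballP; exists (e / ((2 * K + 1) / D)) => /=.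
    exact: divr_gt0.
  by move=> y.
rewrite ltr_pdivlMr// mulrC in xy; apply: le_lt_trans xy.
have [le|/ltW le] := leP x y; have /andP[G0 Gc] := G_slope _ _ le.
  by rewrite distrC ger0_norm// (le_trans Gc)// distrC ger0_norm// subr_ge0.
by rewrite ger0_norm// (le_trans Gc)// ger0_norm// subr_ge0.
Unshelve. all: by end_near. Qed.

Let G_cvgNy : G @ -oo --> (0 : R).
Proof.
apply: cvg_near_cst; near=> x.
have xa : x <= a by near: x; apply: nbhs_ninfty_le; exact: num_real.
rewrite /G /clamp max_l; last by rewrite ge_min xa.
by rewrite !subrr mulr0 addr0 mul0r.
Unshelve. all: by end_near. Qed.

Let G_cvgy : G @ +oo --> (1 : R).
Proof.
apply: cvg_near_cst; near=> x.
have bx : b <= x by near: x; apply: nbhs_pinfty_ge; exact: num_real.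
by rewrite /G /clamp (min_r bx) (max_r (ltW ab)) divff// gt_eqF.
Unshelve. all: by end_near. Qed.

Let Gcum : cumulativeBounded (0 : R) (1 : R) := HB.pack G
  (isCumulative.Build R _ R G G_nd (right_continuousW G_continuous))
  (isCumulativeBounded.Build R 0 1 G G_cvgNy G_cvgy).

(** If [f] is the density of [G], undoing the normalisation gives the density [D * f - (K + 1)] for
    [V]. *)
Lemma lipschitz_FTC : exists f : R -> R,
  [/\ (@lebesgue_measure R).-integrable `[a, b] (EFin \o f),
      forall x y, a <= x -> x <= y -> y <= b ->
        V y - V x = \int[lebesgue_measure]_(t in `[x, y]) f t &
      \forall x \ae lebesgue_measure, a < x < b -> derive1 V x = f x].
Proof.
have [f [f_int GE]] := lipschitz_cumulative_density _ Gcum _ c_gt0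
  (fun x y xy => (andP (G_slope x y xy)).2).
have VE x : a <= x -> x <= b ->
    V x = D * (\int[lebesgue_measure]_(t in `]a, x]) f t) + V a - (K + 1) * (x - a).
  move=> ax xb; rewrite -(GE _ _ ax)/= /G !clampE ?lexx ?(ltW ab)//.
  by field; rewrite gt_eqF.
have f_intS A : measurable A -> lebesgue_measure.-integrable A (EFin \o f).
  by move=> mA; apply: integrableS f_int.
have intD x y : lebesgue_measure.-integrable `[x, y] (EFin \o (fun t => D * f t)).
  by apply: integrableZl_itv_cc; exact: f_intS.
exists (fun x => D * f x - (K + 1)); split.
- exact: (integrableB _ (intD a b) (integrable_cst_itv_cc _ _ _ (K + 1))).
- move=> x y ax xy yb; rewrite RintegralB//; last exact: integrable_cst_itv_cc.
  rewrite [X in _ = _ - X](Rintegral_cst_itv_cc _ _ _ _ xy) RintegralZl//;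
    last exact: f_intS.
  rewrite -Rintegral_itv_obnd_cbnd; last exact: f_intS.
  rewrite -(GE _ _ xy)/= /G !clampE ?(le_trans ax)// ?(le_trans xy)//.
  by field; rewrite gt_eqF.
- have := FTC1 (a := BRight a) (fun y => f_intS _ (measurable_itv _))
    (open_integrable_locally openT f_int).
  apply: filterS.
    exact: (ae_filter_ringOfSetsType lebesgue_measure).
  move=> x /= Hx /andP[ax xb]; have [] := Hx ax.
  set H := fun x => _ => dH H'; rewrite derive1E in H'.
  have isH : is_derive x 1 H (f x) by exact: DeriveDef.
  rewrite derive1E; apply: derive_val.
  (* [V] is controlled only on [[a, b]], so the integral formula can be differentiated only at
     interior points, near which it holds. *)
  apply: (@near_eq_is_derive _ _ _ (fun z => D * H z + V a - (K + 1) * (z - a))).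
    near=> z; apply/esym/VE.
      by apply: ltW; near: z; exact: lt_nbhsr.
    by apply: ltW; near: z; exact: lt_nbhsl.
  apply: is_derive_eq; rewrite /GRing.scale/=; ring.
Unshelve. all: by end_near. Qed.
End lipschitz_FTC.

Lemma ae_le_Rintegral (d : measure_display) (T : measurableType d)
    (R : realType) (mu : {measure set T -> \bar R}) (D : set T) (f g : T -> R) :
  measurable D -> mu.-integrable D (EFin \o f) -> mu.-integrable D (EFin \o g) ->
  (\forall x \ae mu, D x -> f x <= g x) ->
  \int[mu]_(x in D) f x <= \int[mu]_(x in D) g x.
Proof.
move=> mD fi gi fg; rewrite -subr_ge0 -RintegralB//.
have gfi := integrableB mD gi fi.
(* The modulus turns nonnegativity almost everywhere into nonnegativity everywhere without changing
   the integral. *)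
rewrite (_ : Rintegral _ _ _ = \int[mu]_(x in D) `|g x - f x|).
  by apply: Rintegral_ge0.
congr fine; apply: ae_eq_integral => //.
- exact: (measurable_int _ gfi).
- exact: (measurable_int _ (integrable_abse gfi)).
- move: fg; apply: filterS => x fgx Dx.
  by rewrite /= ger0_norm// subr_ge0 fgx.
Qed.

(** A mean value inequality under bounds almost everywhere, by integrating the derivative. The
    Lipschitz condition excludes functions such as Cantor's. *)
Lemma lipschitz_increment_bounds (R : realType) (V : R -> R) (K c1 c2 a b : R) :
  0 <= K -> a < b ->
  (forall x y, a <= x -> x <= y -> y <= b -> `|V y - V x| <= K * (y - x)) ->
  (\forall x \ae @lebesgue_measure R, a < x < b -> c1 <= derive1 V x <= c2) ->
  forall x y, a <= x -> x <= y -> y <= b ->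
    c1 * (y - x) <= V y - V x <= c2 * (y - x).
Proof.
move=> K0 ab V_lip dV x y ax xy yb.
have [f [fi VE fE]] := lipschitz_FTC _ _ _ _ _ K0 ab V_lip.
have f_bounds : \forall t \ae @lebesgue_measure R,
    `[x, y]%classic t -> c1 <= f t <= c2.
  have ab' : \forall t \ae @lebesgue_measure R, `[x, y]%classic t -> a < t < b.
    move: (ae_neq _ a) (ae_neq _ b); apply: filterS2.
      exact: (ae_filter_ringOfSetsType lebesgue_measure).
    move=> t /eqP ta /eqP tb /=; rewrite in_itv/= => /andP[xt ty].
    by rewrite !lt_neqAle (eq_sym a) ta tb (le_trans ax xt) (le_trans ty yb).
  move: dV fE ab'; apply: filterS3.
    exact: (ae_filter_ringOfSetsType lebesgue_measure).
  by move=> t h1 h2 h3 /h3 h; rewrite -h2// h1.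
have fxy : lebesgue_measure.-integrable `[x, y] (EFin \o f).
  apply: integrableS fi => //; apply: subset_itv; rewrite bnd_simp//.
rewrite VE// -!(Rintegral_cst_itv_cc _ _ _ _ xy); apply/andP; split.
- apply: ae_le_Rintegral => //; first exact: integrable_cst_itv_cc.
  move: f_bounds; apply: filterS.
    exact: (ae_filter_ringOfSetsType lebesgue_measure).
  by move=> t h /h/andP[].
- apply: ae_le_Rintegral => //; first exact: integrable_cst_itv_cc.
  move: f_bounds; apply: filterS.
    exact: (ae_filter_ringOfSetsType lebesgue_measure).
  by move=> t h /h/andP[].
Qed.

(** * Pointwise bounds on the velocity and conclusion *)

Lemma Linfty01_ae_le (R : realType) (f : R -> R) (M : R) :
  Linfty01 f = M%:E ->
  \forall x \ae @lebesgue_measure R, 0 <= x <= 1 -> `|f x| <= M.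
Proof.
(* The norm of exponent [+oo] is an essential supremum only on a space of positive measure, which
   [[0, 1]] witnesses. *)
rewrite /Linfty01 unlock ifT; last first.
  have : (@lebesgue_measure R `[0%R, 1%R] <= @lebesgue_measure R setT)%E.
    by apply: le_measure; rewrite ?inE.
  by apply: lt_le_trans; rewrite (lebesgue_measure_itv_cc _ 0 1) ?subr0 ?lte_fin.
move=> fM; have := ess_sup_ge lebesgue_measure (abse \o (EFin \o (f \_ `[0, 1]))).
rewrite fM; apply: filterS => x /= + x01.
by rewrite patchE mem_set//= lee_fin.
Qed.

Theorem lemma3p4 (R : realType) (rho0 V : R -> R)
    (eps h tau : R) (gamma : R -> R -> nat -> R)
    (rho0_Linfty : rho0 \in Lfun (@lebesgue_measure R) +oo%E)
    (rho0_01 : \forall x \ae @lebesgue_measure R, 0 <= rho0 x <= 1)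
    (rho0_TV : (TV rho0 < +oo)%E)
    (V_lip : [lipschitz V x | x in `[0, 1]%classic])
    (V_ge0 : forall x : R, `[0, 1]%classic x -> 0 <= V x)
    (V_dec : \forall x \ae @lebesgue_measure R,
       `[0, 1]%classic x -> derive1 V x <= 0)
    (eps_gt0 : 0 < eps) (h_gt0 : 0 < h) (tau_gt0 : 0 < tau)
    (gamma_noninc : forall k : nat,
       gamma eps h k >= gamma eps h k.+1 /\ gamma eps h k.+1 >= 0)
    (gamma_sum : series (gamma eps h) @ \oo --> (1 : R))
    (gamma_convex : forall k : nat, (1 <= k)%N ->
       gamma eps h k.-1 + gamma eps h k.+1 - 2 * gamma eps h k >= 0)
    (CFL : ((tau / h)%:E * (Linfty01 V + 2%:E * Linfty01 (derive1 V)) <= 1)%E) :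
  let W := scheme_W V (gamma eps h) h tau rho0 in
  forall n : nat,
    (\esum_(j in [set: int]) `|W n.+1 (j + 1)%R - W n.+1 j|%:E
       <= \esum_(j in [set: int]) `|W n (j + 1)%R - W n j|%:E)%E
    /\ (\esum_(j in [set: int]) `|W n (j + 1)%R - W n j|%:E <= TV rho0)%E.
Proof.
have lam_gt0 : 0 < tau / h by exact: divr_gt0.
(* As [tau / h] is positive, an infinite norm would violate the CFL condition; both norms are
   therefore real numbers. *)
have [M [L [ME LE L_ge0 ML]]] : exists M L : R, [/\ Linfty01 V = M%:E,
    Linfty01 (derive1 V) = L%:E, 0 <= L & tau / h * (M + L + L) <= 1].
  have := Lnorm_ge0 lebesgue_measure +oo%E (EFin \o (V \_ `[0, 1])).
  have := Lnorm_ge0 lebesgue_measure +oo%E (EFin \o (derive1 V \_ `[0, 1])).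
  rewrite -!/(Linfty01 _); move: CFL.
  case: (Linfty01 V) => [M| |//]; case: (Linfty01 (derive1 V)) => [L| |//].
  - rewrite -!EFinM !lee_fin => ML L0 _; exists M, L; split => //.
    by move: ML; lra.
  - by rewrite gt0_muley ?lte_fin// addey// gt0_muley ?lte_fin.
  - by rewrite -EFinM addye// gt0_muley ?lte_fin.
  - by rewrite gt0_muley ?lte_fin// addey// gt0_muley ?lte_fin.
(* The Lipschitz property provides the bound for constants strictly above [K0]; [K] is one that is
   also nonnegative. *)
have [K0 [_ HK]] := V_lip; pose K := Num.max 0 (K0 + 1).
have K_ge0 : 0 <= K by rewrite /K le_max lexx.
have VK (x y : R) : 0 <= x -> x <= y -> y <= 1 -> `|V y - V x| <= K * (y - x).
  move=> x0 xy y1; have K0K : K0 < K by rewrite lt_max ltrDl ltr01 orbT.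
  have := HK _ K0K (y, x) => /=.
  rewrite (ger0_norm (_ : 0 <= y - x)) ?subr_ge0//; apply.
  by rewrite !in_itv/= x0 y1 (le_trans xy)// (le_trans x0).
have dV : \forall x \ae @lebesgue_measure R, 0 < x < 1 -> - L <= derive1 V x <= 0.
  move: V_dec (Linfty01_ae_le _ _ _ LE); apply: filterS2.
    exact: (ae_filter_ringOfSetsType lebesgue_measure).
  move=> x h1 h2 /andP[x0 x1].
  have := h2; rewrite (ltW x0) (ltW x1) => /(_ isT).
  rewrite ler_norml => /andP[-> _] /=.
  by apply: h1; rewrite /= in_itv/= (ltW x0) (ltW x1).
have V_slope x y : 0 <= x -> x <= y -> y <= 1 -> 0 <= V x - V y <= L * (y - x).
  move=> x0 xy y1; have /andP[] := lipschitz_increment_bounds _ _ _ _ _ _ _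
    K_ge0 ltr01 VK dV _ _ x0 xy y1.
  lra.
(* The spare [L] of the CFL condition absorbs the passage from an almost
   everywhere bound on [V] to a bound at every point. *)
have V_bound x : 0 <= x <= 1 -> 0 <= V x <= M + L.
  move=> /andP[x0 x1]; rewrite V_ge0/= ?in_itv/= ?x0//.
  (* Applied to the zero function with [c = 0], [average_le_point] merely yields a point [y] of the
     open interval with [|V y| <= M]. Then [V x <= V 0 <= V y + L]. *)
  have c01 (z : R) : 0 <= cst (0 : R) z <= 1 by rewrite /= lexx ler01.
  have [y [/andP[y0 y1] Vy _]] := average_le_point _ _ (measurable_cst _)
    c01 _ _ 0 _ ltr01 (Linfty01_ae_le _ _ _ ME).
  have /andP[Vx _] := V_slope _ _ (lexx 0) x0 x1.
  have /andP[_ V0] := V_slope _ _ (lexx 0) (ltW y0) (ltW y1).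
  have Ly : L * (y - 0) <= L by rewrite subr0 ler_piMr// ltW.
  have := Vy; rewrite (ltW y0) (ltW y1) => /(_ isT) /(le_trans (ler_norm _)); lra.
have mrho0 : measurable_fun [set: R] rho0.
  exact: (set_mem (sub_Lfun_mfun rho0_Linfty)).
have g_noninc k : 0 <= gamma eps h k.+1 <= gamma eps h k.
  by apply/andP; have [] := gamma_noninc k.
have g_convex k : gamma eps h k.+1 - gamma eps h k.+2
    <= gamma eps h k - gamma eps h k.+1.
  by have := gamma_convex k.+1 isT => /=; lra.
have avg01 j : 0 <= cell_average h rho0 j <= 1 by exact: cell_average01_ae.
move=> W n; split.
  by apply: (scheme_variation_noninc _ _ _ _ L (M + L)) => //; exact: ltW.
apply: le_trans (cell_average_variation_le _ _ _ h_gt0 mrho0 rho0_01).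
by apply: (scheme_variation_le _ _ _ _ L (M + L)) => //; exact: ltW.
Qed.
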